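(* Let $\mathcal{M}=(T,S,P,Q,\langle,\rangle_T,\langle,\rangle_S,I,J)$ be a unital Morita context. Then $${}_J\mathcal{L}\subseteq{}_J\mathfrak{F}\subseteq\mathrm{Cogen}({}_S^{\#}P)\quad\text{and}\quad\mathrm{Adstat}^l({}_TP_S)\subseteq\mathrm{Cogen}({}_S^{\#}P).$$ Assume moreover that $\mathbf{Q}_r:=(P,Q_T)$ satisfies the right $\alpha$-condition over $T$. Then: (1) $J_S\subseteq S_S$ is pure and ${}_J\mathcal{C}\subseteq\mathrm{Cogen}({}_S^{\#}P)$. (2) If $\mathbf{P}_r:=(Q,P_S)$ satisfies the right $\alpha$-condition over $S$, then ${}_J\mathcal{L}\subseteq\mathrm{Adstat}^l({}_TP_S)\subseteq\mathrm{Cogen}({}_S^{\#}P)\subseteq{}_J\mathfrak{F}$. (3) If $\mathbf{P}_r$ satisfies the right $\alpha$-condition over $S$ and $\mathrm{Cogen}({}_S^{\#}P)\subseteq{}_J\mathcal{L}$, then ${}_J\mathcal{L}=\mathrm{Cogen}({}_S^{\#}P)=\mathrm{Adstat}^l({}_TP_S)$.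
   Context: All rings are associative with unity and all modules unitary. A unital Morita context $(T,S,P,Q,\langle,\rangle_T,\langle,\rangle_S,I,J)$ consists of rings $T,S$, a $(T,S)$-bimodule $P$, an $(S,T)$-bimodule $Q$, a $(T,T)$-bilinear map $\langle,\rangle_T:P\otimes_SQ\to T$ with image $I$ and an $(S,S)$-bilinear map $\langle,\rangle_S:Q\otimes_TP\to S$ with image $J$, such that $\langle q,p\rangle_Sq'=q\langle p,q'\rangle_T$ and $p\langle q,p'\rangle_S=\langle p,q\rangle_Tp'$ for all $p,p'\in P$, $q,q'\in Q$. $\mathbf{P}_r=(Q,P_S)$ satisfies the right $\alpha$-condition over $S$ if for every left $S$-module $U$ the map $P\otimes_SU\to\mathrm{Hom}_{S}(Q,U)$, $p\otimes u\mapsto[q\mapsto\langle q,p\rangle_Su]$, is injective. $\mathbf{Q}_r=(P,Q_T)$ satisfies the right $\alpha$-condition over $T$ if for every left $T$-module $U$ the map $Q\otimes_TU\to\mathrm{Hom}_{T}(P,U)$, $q\otimes u\mapsto[p\mapsto\langle p,q\rangle_Tu]$, is injective. Fix an injective cogenerator ${}_T\mathbf{E}$ of the category of left $T$-modules; ${}_S^{\#}P:=\mathrm{Hom}_T(P,{}_T\mathbf{E})$ with left $S$-action $(sf)(p)=f(ps)$. Classes of left $S$-modules: $\mathrm{Cogen}({}_S^{\#}P)$ = modules that embed in a direct product $({}_S^{\#}P)^{\Lambda}$; $\mathrm{Adstat}^l({}_TP_S)$ = modules $L$ for which $L\to\mathrm{Hom}_T(P,P\otimes_SL)$, $l\mapsto[p\mapsto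 p\otimes l]$, is an isomorphism; ${}_J\mathfrak{F}$ (resp. ${}_J\mathcal{L}$) = modules $L$ for which $L\to\mathrm{Hom}_S(J,L)$, $l\mapsto[s\mapsto sl]$, is injective (resp. an isomorphism); ${}_J\mathcal{C}$ = modules $L$ for which the multiplication map $J\otimes_SL\to L$ is an isomorphism. ''$J_S\subseteq S_S$ is pure'' means that $J\otimes_SL\to S\otimes_SL\simeq L$ is injective for every left $S$-module $L$. *)

(* Defs.v *)
From HB Require Import structures.
From mathcomp Require Import all_boot ssralg ssrint generic_quotient.
From mathcomp Require Import ring_quotient freeg.
From mathcomp Require Import boolp functions.

Set Implicit Arguments.
Unset Strict Implicit.
Unset Printing Implicit Defensive.

Import GRing.Theory.

Local Open Scope ring_scope.

(* Rings may be zero, hence [pzRingType]. The choice structures carried by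
   rings and modules are no restriction: [boolp] provides them for all types. *)

HB.mixin Record Zmodule_isRmodule (S : pzRingType) V of GRing.Zmodule V := {
  rscale : V -> S -> V;
  rscaleA : forall x a b, rscale (rscale x a) b = rscale x (a * b);
  rscale1 : forall x, rscale x 1 = x;
  rscaleDl : forall x y a, rscale (x + y) a = rscale x a + rscale y a;
  rscaleDr : forall x a b, rscale x (a + b) = rscale x a + rscale x b
}.

#[short(type="rmodType")]
HB.structure Definition Rmodule (S : pzRingType) :=
  { V of GRing.Zmodule V & Zmodule_isRmodule S V }.

Notation "x :* a" := (rscale x a) : ring_scope.

HB.mixin Record Lmodule_Rmodule_isBimodule (T S : pzRingType) V
    of GRing.Lmodule T V & Rmodule S V := {
  scale_rscale : forall (a : T) (x : V) (b : S), a *: (x :* b) = (a *: x) :* b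
}.

#[short(type="bimodType")]
HB.structure Definition Bimodule (T S : pzRingType) :=
  { V of GRing.Lmodule T V & Rmodule S V & Lmodule_Rmodule_isBimodule T S V }.

Section RegularBimodule.
Variable S : pzRingType.

HB.instance Definition _ := Zmodule_isRmodule.Build S S^o
  (fun x a b : S => esym (mulrA x a b)) (@mulr1 S)
  (fun x y a : S => mulrDl x y a) (fun x a b : S => mulrDr x a b).

HB.instance Definition _ := Lmodule_Rmodule_isBimodule.Build S S S^o
  (fun a x b : S => mulrA a x b).

End RegularBimodule.

Record bimodHom (T S : pzRingType) (V W : bimodType T S) := BimodHom {
  bimod_hom :> {linear V -> W};
  bimod_homR : forall x (a : S), bimod_hom (x :* a) = bimod_hom x :* a
}.

Section Image.
Variables (T S : pzRingType) (V W : bimodType T S) (f : bimodHom V W).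

Definition bimod_im : {pred W} := fun w => `[< exists v, f v = w >].

Lemma bimod_im_submod : submod_closed bimod_im.
Proof.
split; first by apply/asboolP; exists 0; rewrite linear0.
move=> a x y /asboolP[v <-] /asboolP[w <-]; apply/asboolP.
by exists (a *: v + w); rewrite linearP.
Qed.

HB.instance Definition _ := GRing.isSubmodClosed.Build T W bimod_im
  bimod_im_submod.

Definition bimod_image := {w : W | w \in bimod_im}.

HB.instance Definition _ := SubChoice.on bimod_image.
HB.instance Definition _ :=
  GRing.SubChoice_isSubLmodule.Build T W bimod_im bimod_image bimod_im_submod.

Lemma bimod_im_rscale (x : bimod_image) (a : S) : val x :* a \in bimod_im.
Proof.
have /asboolP[v e] := valP x.
by apply/asboolP; exists (v :* a); rewrite bimod_homR e.
Qed.

Definition image_rscale (x : bimod_image) (a : S) : bimod_image :=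
  Sub (val x :* a) (bimod_im_rscale x a).

Fact image_rscaleA x a b :
  image_rscale (image_rscale x a) b = image_rscale x (a * b).
Proof. by apply: val_inj; rewrite /= rscaleA. Qed.

Fact image_rscale1 x : image_rscale x 1 = x.
Proof. by apply: val_inj; rewrite /= rscale1. Qed.

Fact image_rscaleDl x y a :
  image_rscale (x + y) a = image_rscale x a + image_rscale y a.
Proof. by apply: val_inj; rewrite /= rscaleDl. Qed.

Fact image_rscaleDr x a b :
  image_rscale x (a + b) = image_rscale x a + image_rscale x b.
Proof. by apply: val_inj; rewrite /= rscaleDr. Qed.

HB.instance Definition _ := Zmodule_isRmodule.Build S bimod_image
  image_rscaleA image_rscale1 image_rscaleDl image_rscaleDr.

Fact image_scale_rscale (a : T) (x : bimod_image) (b : S) :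
  a *: (x :* b) = (a *: x) :* b.
Proof. by apply: val_inj; rewrite /= scale_rscale. Qed.

HB.instance Definition _ := Lmodule_Rmodule_isBimodule.Build T S bimod_image
  image_scale_rscale.

Definition image_incl : bimodHom bimod_image W :=
  @BimodHom T S bimod_image W (val : {linear bimod_image -> W})
    (fun _ _ => erefl).

End Image.

Section Tensor.
Variables (S : pzRingType) (M : rmodType S) (U : lmodType S).

Local Notation gen m u := (<< (m, u) >> : {freeg (M * U)%type / int}).

Inductive tensor_rel : {freeg (M * U)%type / int} -> Prop :=
  | tensor_rel0 : tensor_rel 0
  | tensor_relB x y : tensor_rel x -> tensor_rel y -> tensor_rel (x - y)
  | tensor_relDl m m' u : tensor_rel (gen (m + m') u - (gen m u + gen m' u))
  | tensor_relDr m u u' : tensor_rel (gen m (u + u') - (gen m u + gen m u'))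
  | tensor_relM m a u : tensor_rel (gen (m :* a) u - gen m (a *: u)).

Definition tensor_relb : {pred {freeg (M * U)%type / int}} :=
  fun x => `[< tensor_rel x >].

Fact tensor_rel_zmod : zmod_closed tensor_relb.
Proof.
split; first exact/asboolP/tensor_rel0.
by move=> x y /asboolP hx /asboolP hy; apply/asboolP/tensor_relB.
Qed.

HB.instance Definition _ :=
  GRing.isZmodClosed.Build {freeg (M * U)%type / int} tensor_relb
    tensor_rel_zmod.

Definition tensor := Quotient.quot tensor_relb.

HB.instance Definition _ := GRing.Zmodule.on tensor.

Definition tens (m : M) (u : U) : tensor := \pi_tensor%qT (gen m u).

Lemma tensDl m m' u : tens (m + m') u = tens m u + tens m' u.
Proof.
rewrite /tens -raddfD; apply/eqP; rewrite -Quotient.idealrBE.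
exact/asboolP/tensor_relDl.
Qed.

Lemma tensDr m u u' : tens m (u + u') = tens m u + tens m u'.
Proof.
rewrite /tens -raddfD; apply/eqP; rewrite -Quotient.idealrBE.
exact/asboolP/tensor_relDr.
Qed.

Lemma tensM m a u : tens (m :* a) u = tens m (a *: u).
Proof. by apply/eqP; rewrite -Quotient.idealrBE; exact/asboolP/tensor_relM. Qed.

Definition balanced (A : zmodType) (f : M -> U -> A) :=
  [/\ forall m m' u, f (m + m') u = f m u + f m' u,
      forall m u u', f m (u + u') = f m u + f m u' &
      forall m a u, f (m :* a) u = f m (a *: u)].

Section Lift.
Variables (A : zmodType) (f : M -> U -> A) (fP : balanced f).

(* [zmodule A] is [A] seen as a [Z]-module, as [fglift] requires. *)
Let ev (D : {freeg (M * U)%type / int}) : A :=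
  fglift (fun mu => f mu.1 mu.2 : zmodule A) D.

Let evB x y : ev (x - y) = ev x - ev y.
Proof. exact: (lift_is_additive (M := zmodule A)). Qed.

Let evU m u : ev (gen m u) = f m u.
Proof. by rewrite /ev (liftU (M := zmodule A)) scale1r. Qed.

Let ev0 : ev 0 = 0. Proof. by have := evB 0 0; rewrite !subrr. Qed.

Let evD x y : ev (x + y) = ev x + ev y.
Proof.
have evN z : ev (- z) = - ev z by rewrite -[- z]sub0r evB ev0 sub0r.
by have := evB x (- y); rewrite evN !opprK.
Qed.

Let ev_rel x : tensor_rel x -> ev x = 0.
Proof.
case: fP => fl fr fm; elim=> {x}.
- exact: ev0.
- by move=> x y _ hx _ hy; rewrite evB hx hy subrr.
- by move=> m m' u; rewrite evB evD !evU fl subrr.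
- by move=> m u u'; rewrite evB evD !evU fr subrr.
- by move=> m a u; rewrite evB !evU fm subrr.
Qed.

Definition tlift_fun (z : tensor) : A := ev (repr z).

Let tlift_pi x : tlift_fun (\pi_tensor%qT x) = ev x.
Proof.
apply/eqP; rewrite -subr_eq0 -evB; apply/eqP/ev_rel/asboolP.
have := Quotient.idealrBE tensor_relb (repr (\pi_tensor%qT x)) x.
by rewrite reprK eqxx.
Qed.

Fact tlift_zmod : zmod_morphism tlift_fun.
Proof.
move=> x y; rewrite -[x]reprK -[y]reprK -raddfB !tlift_pi evB.
by rewrite /tlift_fun.
Qed.

HB.instance Definition _ :=
  GRing.isZmodMorphism.Build tensor A tlift_fun tlift_zmod.

Definition tlift : {additive tensor -> A} := tlift_fun.

Lemma tliftE m u : tlift (tens m u) = f m u.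
Proof. by rewrite /= tlift_pi evU. Qed.

End Lift.

Lemma tensor_ind (P : tensor -> Prop) :
    (forall m u, P (tens m u)) -> (forall x y, P x -> P y -> P (x + y)) ->
  forall x, P x.
Proof.
move=> Pt PD.
have t0 u : tens 0 u = 0.
  by apply: (addrI (tens 0 u)); rewrite -tensDl !addr0.
have P0 : P 0 by rewrite -(t0 0).
have PN m u : P (- tens m u).
  have -> : - tens m u = tens (- m) u; last exact: Pt.
  by apply/eqP; rewrite eq_sym -addr_eq0 -tensDl addNr t0.
have Pn x n : P x -> P (x *+ n).
  by move=> Px; elim: n => [|n IH] //; rewrite mulrS; exact: PD.
have Pz m u (n : int) : P (tens m u *~ n).
  case: n => n; first exact: Pn.
  by rewrite NegzE mulrNz -mulNrz; exact: Pn.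
move=> x; rewrite -[x]reprK -[repr x]freeg_sumE raddf_sum.
elim/big_ind: _ => // -[m u] _.
by rewrite -[coeff _ _]intz -freegU_mulz raddfMz; exact: Pz.
Qed.

Lemma additive_tensorP (A : zmodType) (f g : {additive tensor -> A}) :
  (forall m u, f (tens m u) = g (tens m u)) -> f =1 g.
Proof. by move=> fg x; elim/tensor_ind: x => // x y; rewrite !raddfD => -> ->. Qed.

End Tensor.

Notation "x ⊗ y" := (tens x y) (at level 40, no associativity) : ring_scope.

Section TensorLmodule.
Variables (T S : pzRingType) (M : bimodType T S) (U : lmodType S).

Fact tensor_scale_balanced (a : T) :
  balanced (fun (m : M) (u : U) => (a *: m) ⊗ u).
Proof.
split=> *; first by rewrite scalerDr tensDl.
- by rewrite tensDr.
- by rewrite scale_rscale tensM.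
Qed.

Definition tensor_scale (a : T) : {additive tensor M U -> tensor M U} :=
  tlift (tensor_scale_balanced a).

Fact tensor_scaleE a m u : tensor_scale a (m ⊗ u) = (a *: m) ⊗ u.
Proof. exact: tliftE. Qed.

Fact tensor_scaleA a b x :
  tensor_scale a (tensor_scale b x) = tensor_scale (a * b) x.
Proof.
elim/tensor_ind: x => [m u|x y hx hy]; last by rewrite !raddfD hx hy.
by rewrite !tensor_scaleE scalerA.
Qed.

Fact tensor_scale1 : left_id 1 tensor_scale.
Proof.
move=> x; elim/tensor_ind: x => [m u|x y hx hy]; last by rewrite !raddfD hx hy.
by rewrite tensor_scaleE scale1r.
Qed.

Fact tensor_scaleDr : right_distributive (fun a => tensor_scale a) +%R.
Proof. by move=> a x y; rewrite raddfD. Qed.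

Fact tensor_scaleDl x :
  {morph (fun a => tensor_scale a x) : a b / a + b >-> a + b}.
Proof.
move=> a b; elim/tensor_ind: x => [m u|x y hx hy].
  by rewrite !tensor_scaleE scalerDl tensDl.
by rewrite !raddfD hx hy addrACA.
Qed.

HB.instance Definition _ := GRing.Zmodule_isLmodule.Build T (tensor M U)
  tensor_scaleA tensor_scale1 tensor_scaleDr tensor_scaleDl.

Lemma tensZ (a : T) (m : M) (u : U) : a *: (m ⊗ u) = (a *: m) ⊗ u.
Proof. exact: tensor_scaleE. Qed.

End TensorLmodule.

Section TensorRmodule.
Variables (S R : pzRingType) (M : rmodType S) (U : bimodType S R).

Fact tensor_rscale_balanced (a : R) :
  balanced (fun (m : M) (u : U) => m ⊗ (u :* a)).
Proof.
split=> *; first by rewrite tensDl.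
- by rewrite rscaleDl tensDr.
- by rewrite tensM scale_rscale.
Qed.

Definition tensor_rscale_add (a : R) : {additive tensor M U -> tensor M U} :=
  tlift (tensor_rscale_balanced a).

Definition tensor_rscale x a := tensor_rscale_add a x.

Fact tensor_rscaleE a m u : tensor_rscale (m ⊗ u) a = m ⊗ (u :* a).
Proof. exact: tliftE. Qed.

Fact tensor_rscaleDl x y a :
  tensor_rscale (x + y) a = tensor_rscale x a + tensor_rscale y a.
Proof. by rewrite /tensor_rscale raddfD. Qed.

Fact tensor_rscaleA x a b :
  tensor_rscale (tensor_rscale x a) b = tensor_rscale x (a * b).
Proof.
elim/tensor_ind: x => [m u|x y hx hy]; last by rewrite !tensor_rscaleDl hx hy.
by rewrite !tensor_rscaleE rscaleA.
Qed.

Fact tensor_rscale1 x : tensor_rscale x 1 = x.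
Proof.
elim/tensor_ind: x => [m u|x y hx hy]; last by rewrite !tensor_rscaleDl hx hy.
by rewrite tensor_rscaleE rscale1.
Qed.

Fact tensor_rscaleDr x a b :
  tensor_rscale x (a + b) = tensor_rscale x a + tensor_rscale x b.
Proof.
elim/tensor_ind: x => [m u|x y hx hy].
  by rewrite !tensor_rscaleE rscaleDr tensDr.
by rewrite !tensor_rscaleDl hx hy addrACA.
Qed.

HB.instance Definition _ := Zmodule_isRmodule.Build R (tensor M U)
  tensor_rscaleA tensor_rscale1 tensor_rscaleDl tensor_rscaleDr.

Lemma tens_rscale (a : R) (m : M) (u : U) : (m ⊗ u) :* a = m ⊗ (u :* a).
Proof. exact: tensor_rscaleE. Qed.

End TensorRmodule.

Section TensorBimodule.
Variables (T S R : pzRingType) (M : bimodType T S) (U : bimodType S R).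

Fact tensor_scale_rscale (a : T) (x : tensor M U) (b : R) :
  a *: (x :* b) = (a *: x) :* b.
Proof.
elim/tensor_ind: x => [m u|x y hx hy].
  by rewrite tens_rscale !tensZ tens_rscale.
by rewrite rscaleDl !scalerDr hx hy rscaleDl.
Qed.

HB.instance Definition _ :=
  Lmodule_Rmodule_isBimodule.Build T R (tensor M U) tensor_scale_rscale.

End TensorBimodule.

Section Hom.
Variables (T : pzRingType) (M N : lmodType T).

Definition Hom := {linear M -> N}.

Lemma HomP (f g : Hom) : f =1 g -> f = g.
Proof.
case: f => f [] [c1] [c2]; case: g => g [] [d1] [d2] /= /funext fg.
by subst g; rewrite (Prop_irrelevance c1 d1) (Prop_irrelevance c2 d2).
Qed.

HB.instance Definition _ := gen_eqMixin Hom.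
HB.instance Definition _ := gen_choiceMixin Hom.

Definition hom0 : Hom := \0.
Definition hom_opp (f : Hom) : Hom := \- f.
Definition hom_add (f g : Hom) : Hom := f \+ g.

Fact hom_addA : associative hom_add.
Proof. by move=> f g h; apply: HomP => x /=; rewrite addrA. Qed.

Fact hom_addC : commutative hom_add.
Proof. by move=> f g; apply: HomP => x /=; rewrite addrC. Qed.

Fact hom_add0 : left_id hom0 hom_add.
Proof. by move=> f; apply: HomP => x /=; rewrite add0r. Qed.

Fact hom_addN : left_inverse hom0 hom_opp hom_add.
Proof. by move=> f; apply: HomP => x /=; rewrite addNr. Qed.

HB.instance Definition _ :=
  GRing.isZmodule.Build Hom hom_addA hom_addC hom_add0 hom_addN.

End Hom.

Section HomLmodule.
Variables (T S : pzRingType) (M : bimodType T S) (N : lmodType T).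

Definition hom_scale_fun (a : S) (f : Hom M N) : M -> N := fun x => f (x :* a).

Fact hom_scale_linear a f : linear (hom_scale_fun a f).
Proof.
by move=> b x y; rewrite /hom_scale_fun rscaleDl -scale_rscale linearP.
Qed.

HB.instance Definition _ a f :=
  GRing.isLinear.Build T M N *:%R (hom_scale_fun a f) (hom_scale_linear a f).

Definition hom_scale (a : S) (f : Hom M N) : Hom M N := hom_scale_fun a f.

Fact hom_scaleA a b f : hom_scale a (hom_scale b f) = hom_scale (a * b) f.
Proof. by apply: HomP => x; rewrite /= /hom_scale_fun /= -rscaleA. Qed.

Fact hom_scale1 : left_id 1 hom_scale.
Proof. by move=> f; apply: HomP => x; rewrite /= /hom_scale_fun rscale1. Qed.

Fact hom_scaleDr : right_distributive hom_scale +%R.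
Proof. by move=> a f g; apply: HomP. Qed.

Fact hom_scaleDl f : {morph hom_scale^~ f : a b / a + b}.
Proof.
by move=> a b; apply: HomP => x; rewrite /= /hom_scale_fun rscaleDr raddfD.
Qed.

HB.instance Definition _ := GRing.Zmodule_isLmodule.Build S (Hom M N)
  hom_scaleA hom_scale1 hom_scaleDr hom_scaleDl.

End HomLmodule.

(* The left [S]-module [#P = Hom_T(P, E)]. *)
Definition sharp (T S : pzRingType) (P : bimodType T S) (E : lmodType T) :
  lmodType S := Hom P E.

Definition cogen (R : pzRingType) (V L : lmodType R) : Prop :=
  exists (I : Type) (f : {linear L -> (I -> V)}), injective f.

Definition injective_module (R : pzRingType) (E : lmodType R) : Prop :=
  forall (A B : lmodType R) (i : {linear A -> B}) (f : {linear A -> E}),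
    injective i -> exists g : {linear B -> E}, forall x, g (i x) = f x.

Definition cogenerator (R : pzRingType) (E : lmodType R) : Prop :=
  forall L : lmodType R, cogen E L.

Section Adstat.
Variables (T S : pzRingType) (P : bimodType T S) (L : lmodType S).

Definition tens_right (l : L) : P -> tensor P L := fun p => p ⊗ l.

Fact tens_right_linear l : linear (tens_right l).
Proof. by move=> a p p'; rewrite /tens_right tensDl tensZ. Qed.

HB.instance Definition _ l := GRing.isLinear.Build T P (tensor P L) *:%R
  (tens_right l) (tens_right_linear l).

Definition adstat_fun (l : L) : Hom P (tensor P L) := tens_right l.

Fact adstat_linear : linear adstat_fun.
Proof.
move=> a l l'; apply: HomP => p.
by rewrite /= /tens_right tensDr /= /hom_scale_fun /= /tens_right tensM.
Qed.

HB.instance Definition _ := GRing.isLinear.Build S L (Hom P (tensor P L)) *:%R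
  adstat_fun adstat_linear.

Definition adstat_map : {linear L -> Hom P (tensor P L)} := adstat_fun.

Definition adstat : Prop := bijective adstat_map.

End Adstat.

Section TensorMap.
Variables (R S : pzRingType) (M N : bimodType R S) (f : bimodHom M N).
Variable L : lmodType S.

Fact tensor_map_balanced : balanced (fun (m : M) (l : L) => f m ⊗ l).
Proof.
split=> *; first by rewrite raddfD tensDl.
- by rewrite tensDr.
- by rewrite bimod_homR tensM.
Qed.

Definition tensor_map : {additive tensor M L -> tensor N L} :=
  tlift tensor_map_balanced.

End TensorMap.

Definition pure_right (R S : pzRingType) (M N : bimodType R S)
    (f : bimodHom M N) : Prop :=
  forall L : lmodType S, injective (tensor_map f L).

Record rpairing (S : pzRingType) (V : lmodType S) (W : rmodType S) := RPairing {
  rpair :> V -> W -> S;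
  rpairDl : forall v v' w, rpair (v + v') w = rpair v w + rpair v' w;
  rpairDr : forall v w w', rpair v (w + w') = rpair v w + rpair v w';
  rpairZl : forall a v w, rpair (a *: v) w = a * rpair v w;
  rpairZr : forall v w a, rpair v (w :* a) = rpair v w * a
}.

Section PairingOf.
Variables (R S : pzRingType) (V : bimodType S R) (W : bimodType R S).
Variable f : bimodHom (tensor V W) S^o.

Let b (v : V) (w : W) : S := f (v ⊗ w).

Fact pairing_ofDl v v' w : b (v + v') w = b v w + b v' w.
Proof. by rewrite /b tensDl linearD. Qed.

Fact pairing_ofDr v w w' : b v (w + w') = b v w + b v w'.
Proof. by rewrite /b tensDr linearD. Qed.

Fact pairing_ofZl a v w : b (a *: v) w = a * b v w.
Proof. by rewrite /b -tensZ linearZ. Qed.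

Fact pairing_ofZr v w a : b v (w :* a) = b v w * a.
Proof. by rewrite /b -tens_rscale bimod_homR. Qed.

Definition pairing_of : rpairing V W :=
  RPairing pairing_ofDl pairing_ofDr pairing_ofZl pairing_ofZr.

End PairingOf.

Section Alpha.
Variables (S : pzRingType) (V : lmodType S) (W : rmodType S).
Variables (b : rpairing V W) (U : lmodType S).

Definition alpha_fun (w : W) (u : U) : V -> U := fun v => b v w *: u.

Fact alpha_fun_linear w u : linear (alpha_fun w u).
Proof.
by move=> a v v'; rewrite /alpha_fun rpairDl rpairZl scalerDl scalerA.
Qed.

HB.instance Definition _ w u :=
  GRing.isLinear.Build S V U *:%R (alpha_fun w u) (alpha_fun_linear w u).

Definition alpha_hom (w : W) (u : U) : Hom V U := alpha_fun w u.

Fact alpha_balanced : balanced alpha_hom.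
Proof.
split=> *; apply: HomP => v; rewrite /= /alpha_fun.
- by rewrite rpairDr scalerDl.
- by rewrite scalerDr.
- by rewrite rpairZr scalerA.
Qed.

Definition alpha_map : {additive tensor W U -> Hom V U} :=
  tlift alpha_balanced.

End Alpha.

Definition right_alpha (S : pzRingType) (V : lmodType S) (W : rmodType S)
    (b : rpairing V W) : Prop :=
  forall U : lmodType S, injective (alpha_map b U).

Record moritaContext (T S : pzRingType) (P : bimodType T S)
    (Q : bimodType S T) := MoritaContext {
  formT : bimodHom (tensor P Q) T^o;
  formS : bimodHom (tensor Q P) S^o;
  formSQ : forall (q : Q) (p : P) (q' : Q),
    (formS (q ⊗ p) : S) *: q' = q :* (formT (p ⊗ q') : T);
  formPS : forall (p : P) (q : Q) (p' : P),
    p :* (formS (q ⊗ p') : S) = (formT (p ⊗ q) : T) *: p'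
}.

Section MoritaContext.
Variables (T S : pzRingType) (P : bimodType T S) (Q : bimodType S T).
Variable c : moritaContext P Q.

(* The trace ideals [I] of [T] and [J] of [S]. *)
Definition idealI : bimodType T T := bimod_image (formT c).
Definition idealJ : bimodType S S := bimod_image (formS c).

Definition inclJ : bimodHom idealJ S^o := image_incl (formS c).

(* The pairings [P_r = (Q, P_S)] and [Q_r = (P, Q_T)]. *)
Definition pairing_Pr : rpairing Q P := pairing_of (formS c).
Definition pairing_Qr : rpairing P Q := pairing_of (formT c).

Section IdealClasses.
Variable L : lmodType S.

Definition actJ_fun (l : L) : idealJ -> L := fun s => (inclJ s : S) *: l.

Fact actJ_fun_linear l : linear (actJ_fun l).
Proof. by move=> a s s'; rewrite /actJ_fun linearP scalerDl scalerA. Qed.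

HB.instance Definition _ l :=
  GRing.isLinear.Build S idealJ L *:%R (actJ_fun l) (actJ_fun_linear l).

Definition actJ_hom (l : L) : Hom idealJ L := actJ_fun l.

Fact actJ_linear : linear actJ_hom.
Proof.
move=> a l l'; apply: HomP => s.
by rewrite /= /hom_scale_fun /= /actJ_fun scalerDr bimod_homR scalerA.
Qed.

HB.instance Definition _ :=
  GRing.isLinear.Build S L (Hom idealJ L) *:%R actJ_hom actJ_linear.

Definition actJ_map : {linear L -> Hom idealJ L} := actJ_hom.

Fact multJ_balanced : balanced (fun (s : idealJ) (l : L) => (inclJ s : S) *: l).
Proof.
split=> *; first by rewrite raddfD scalerDl.
- by rewrite scalerDr.
- by rewrite bimod_homR scalerA.
Qed.

Definition multJ_map : {additive tensor idealJ L -> L} := tlift multJ_balanced.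

Definition classJF : Prop := injective actJ_map.
Definition classJL : Prop := bijective actJ_map.
Definition classJC : Prop := bijective multJ_map.

End IdealClasses.

End MoritaContext.

(* Main.v *)
(** Cogen(#P) consists of the modules [L] on which [P] is tensor-faithful: if
    [p ⊗ l = 0] for all [p] then [l = 0], that is, [L -> Hom(P, P ⊗ L)] is
    injective. Indeed a cogenerator [E] separates the points of [P ⊗ L], and
    conversely [p ⊗ l |-> f l i p] is well defined for [f : L -> (#P)^I].

    Under the condition on [Q_r], for [z : Q ⊗ (P ⊗ L)] with image [x] in
    [J ⊗ L], the map [alpha z] is [p |-> p ⊗ mult x]; so [mult x = 0] forces
    [z = 0] and [x = 0].

    For JL ⊆ Adstat, [g : P -> P ⊗ L] induces
    [h : J -> L, <q, p> |-> alpha (g p) q], which is well defined because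
    [<q, p> h(s) = alpha (g (p s)) q] and [L] is in JF; an [l] with
    [h(s) = s l] then represents [g], by the condition on [P_r]. *)

From HB Require Import structures.
Require Import Defs.
From mathcomp Require Import all_boot ssralg.
From mathcomp Require Import boolp functions.

Set Implicit Arguments.
Unset Strict Implicit.
Unset Printing Implicit Defensive.

Import GRing.Theory.

Local Open Scope ring_scope.

(** * Tensor-faithfulness and cogeneration by #P *)

Section TensorFaithful.
Variables (T S : pzRingType) (P : bimodType T S) (L : lmodType S).

Definition tensor_faithful := forall l : L, (forall p : P, p ⊗ l = 0) -> l = 0.

Lemma adstat_tensor_faithful : adstat P L -> tensor_faithful.
Proof.
move=> /bij_inj inj l h; apply: inj; rewrite raddf0.
by apply: HomP => p; exact: h.
Qed.

Section Separate.
Variables (E : lmodType T) (I : Type) (f : {linear tensor P L -> (I -> E)}).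

(** The transpose of [f] under the tensor-hom adjunction, one coordinate at a time. *)
Definition sep_fun (l : L) (i : I) : P -> E := fun p => f (p ⊗ l) i.

Fact sep_fun_linear l i : linear (sep_fun l i).
Proof. by move=> a p p'; rewrite /sep_fun tensDl -tensZ linearP. Qed.

HB.instance Definition _ l i :=
  GRing.isLinear.Build T P E *:%R (sep_fun l i) (sep_fun_linear l i).

Definition sep (l : L) : I -> sharp P E := fun i => (sep_fun l i : Hom P E).

Fact sep_linear : linear sep.
Proof.
move=> a l l'; apply/funext => i; apply: HomP => p.
by rewrite /= /hom_scale_fun /= /sep_fun tensDr -tensM raddfD.
Qed.

HB.instance Definition _ :=
  GRing.isLinear.Build S L (I -> sharp P E) *:%R sep sep_linear.

End Separate.

Lemma tensor_faithful_cogen (E : lmodType T) :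
  cogenerator E -> tensor_faithful -> cogen (sharp P E) L.
Proof.
move=> /(_ (tensor P L))[I [f f_inj]] Lf; exists I, (sep f : {linear _ -> _}).
apply: raddf_inj => l l0; apply: Lf => p; apply: f_inj; rewrite raddf0.
apply/funext => i.
exact: (congr1 (fun g : I -> sharp P E => (g i : Hom P E) p) l0).
Qed.

Lemma cogen_tensor_faithful (E : lmodType T) :
  cogen (sharp P E) L -> tensor_faithful.
Proof.
move=> [I [f f_inj]] l l0; apply: f_inj; rewrite raddf0.
apply/funext => i; apply: HomP => p.
have bal : balanced (fun (p : P) (l : L) => (f l i : Hom P E) p).
  split=> [p1 p2 l1|p1 l1 l2|p1 a l1]; first by rewrite raddfD.
  - by rewrite raddfD.
  - by rewrite linearZ.
by have := tliftE bal p l; rewrite l0 raddf0 => <-.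
Qed.

End TensorFaithful.

(** * The trace ideal J as an image of Q ⊗ P, and the class JF *)

Section Morita.
Variables (T S : pzRingType) (P : bimodType T S) (Q : bimodType S T).
Variable c : moritaContext P Q.

Section ToJ.

Fact toJ_subproof (z : tensor Q P) : formS c z \in bimod_im (formS c).
Proof. by apply/asboolP; exists z. Qed.

Definition toJ (z : tensor Q P) : idealJ c := Sub (formS c z) (toJ_subproof z).

Fact toJ_linear : linear toJ.
Proof. by move=> a x y; apply: val_inj; rewrite /= linearP. Qed.

HB.instance Definition _ :=
  GRing.isLinear.Build S (tensor Q P) (idealJ c) *:%R toJ toJ_linear.

Lemma toJ_rscale z (a : S) : toJ (z :* a) = toJ z :* a.
Proof. by apply: val_inj; rewrite /= bimod_homR. Qed.

Lemma toJ_surj (s : idealJ c) : exists z, toJ z = s.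
Proof. by have /asboolP[z e] := valP s; exists z; apply: val_inj. Qed.

End ToJ.

Variable L : lmodType S.

(** The values <q, p> generate J additively, so annihilation of [l] by J can be tested on them. *)
Lemma classJFP :
  classJF c L <-> forall l : L,
    (forall (q : Q) (p : P), (formS c (q ⊗ p) : S) *: l = 0) -> l = 0.
Proof.
split=> [inj l h|h].
  apply: inj; rewrite raddf0; apply: HomP => s.
  have [z <-] := toJ_surj s; rewrite /= /actJ_fun /=.
  elim/tensor_ind: z => // x y; rewrite linearD scalerDl => -> ->.
  exact: addr0.
apply: raddf_inj => l l0; apply: h => q p.
exact: (congr1 (fun f : Hom (idealJ c) L => f (toJ (q ⊗ p))) l0).
Qed.

Lemma alpha_PrE q p l :
  alpha_map (pairing_Pr c) L (p ⊗ l) q = (formS c (q ⊗ p) : S) *: l.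
Proof. by rewrite tliftE. Qed.

Lemma alpha_QrE (U : lmodType T) q (u : U) p :
  alpha_map (pairing_Qr c) U (q ⊗ u) p = (formT c (p ⊗ q) : T) *: u.
Proof. by rewrite tliftE. Qed.

(** The alpha map sends p ⊗ l to q |-> <q, p> l, so J annihilates [l] as soon as every p ⊗ l
    vanishes. *)
Lemma classJF_tensor_faithful : classJF c L -> tensor_faithful P L.
Proof.
move=> /classJFP h l l0; apply: h => q p.
by rewrite -alpha_PrE l0 raddf0.
Qed.

Lemma tensor_faithful_classJF :
  right_alpha (pairing_Pr c) -> tensor_faithful P L -> classJF c L.
Proof.
move=> al Lf; apply/classJFP => l l0; apply: Lf => p; apply: (al L).
by rewrite raddf0; apply: HomP => q; rewrite alpha_PrE l0.
Qed.

(** * Comparison of Q ⊗ (P ⊗ L) with J ⊗ L; consequences of the condition on Q_r *)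

Section ToJTensor.

Fact toJ_tens_balanced q :
  balanced (fun (p : P) (l : L) => toJ (q ⊗ p) ⊗ l).
Proof.
split=> *; first by rewrite tensDr raddfD tensDl.
- by rewrite tensDr.
- by rewrite -tens_rscale toJ_rscale tensM.
Qed.

Fact toJ_tensor_balanced :
  balanced (fun (q : Q) (x : tensor P L) => tlift (toJ_tens_balanced q) x).
Proof.
split=> [q q' x|q x y|q t x]; last 2 first.
- by rewrite raddfD.
- elim/tensor_ind: x => [p l|x y hx hy]; last by rewrite scalerDr !raddfD hx hy.
  by rewrite tensZ !tliftE tensM.
elim/tensor_ind: x => [p l|x y hx hy]; first by rewrite !tliftE tensDl raddfD tensDl.
by rewrite !raddfD hx hy addrACA.
Qed.

(** Associativity to (Q ⊗ P) ⊗ L followed by [toJ] ⊗ L, obtained in one go by a double lift. *)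
Definition toJ_tensor : {additive tensor Q (tensor P L) -> tensor (idealJ c) L} :=
  tlift toJ_tensor_balanced.

Lemma toJ_tensorE q p l : toJ_tensor (q ⊗ (p ⊗ l)) = toJ (q ⊗ p) ⊗ l.
Proof. by rewrite !tliftE. Qed.

Lemma toJ_tensor_surj x : exists z, toJ_tensor z = x.
Proof.
elim/tensor_ind: x => [s l|x y [z <-] [w <-]]; last by exists (z + w); rewrite raddfD.
have [z <-] := toJ_surj s; elim/tensor_ind: z => [q p|x y [z hz] [w hw]].
  by exists (q ⊗ (p ⊗ l)); rewrite toJ_tensorE.
by exists (z + w); rewrite !raddfD hz hw tensDl.
Qed.

Lemma multJE (s : idealJ c) l : multJ_map c L (s ⊗ l) = (val s : S) *: l.
Proof. exact: tliftE. Qed.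

(** On generators, <p, q> p' ⊗ l = p <q, p'> ⊗ l = p ⊗ <q, p'> l. *)
Lemma alpha_Qr_toJ z (p : P) :
  alpha_map (pairing_Qr c) (tensor P L) z p = p ⊗ multJ_map c L (toJ_tensor z).
Proof.
elim/tensor_ind: z => [q x|x y hx hy]; last by rewrite !raddfD tensDr -hx -hy.
rewrite alpha_QrE; elim/tensor_ind: x => [p' l|x y hx hy].
  by rewrite toJ_tensorE multJE tensZ -formPS tensM.
by rewrite scalerDr hx hy !(tensDr, raddfD).
Qed.

Lemma multJ_eq0 (al : right_alpha (pairing_Qr c)) x :
  (forall p : P, p ⊗ multJ_map c L x = 0) -> x = 0.
Proof.
have [z <-] := toJ_tensor_surj x => h.
suff -> : z = 0 by rewrite raddf0.
apply: (al (tensor P L)); rewrite raddf0; apply: HomP => p.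
by rewrite alpha_Qr_toJ h.
Qed.

End ToJTensor.

Lemma classJC_tensor_faithful :
  right_alpha (pairing_Qr c) -> classJC c L -> tensor_faithful P L.
Proof.
move=> al [m' _ mK] l l0.
by rewrite -(mK l) (@multJ_eq0 al (m' l)) ?raddf0 // => p; rewrite mK.
Qed.

Lemma tensor_map_inclJ_inj :
  right_alpha (pairing_Qr c) -> injective (tensor_map (inclJ c) L).
Proof.
move=> al; apply: raddf_inj => x x0; apply: (multJ_eq0 al) => p.
suff -> : multJ_map c L x = 0 by apply: (addrI (p ⊗ 0)); rewrite -tensDr !addr0.
(* Multiplication on J ⊗ L factors through S ⊗ L -> L, the lift of [bal], so it kills [x]. *)
have bal : balanced (fun (s : S^o) (l : L) => (s : S) *: l).
  split=> [s s' l|s l l'|s a l]; first exact: scalerDl.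
  - exact: scalerDr.
  - by rewrite scalerA.
rewrite -[RHS](raddf0 (tlift bal)) -x0.
elim/tensor_ind: x {x0} => [s l|x y hx hy]; last by rewrite !raddfD hx hy.
by rewrite !tliftE.
Qed.

(** * Representing maps P -> P ⊗ L by elements of L *)

Section Representing.
Variable g : Hom P (tensor P L).

Local Notation alpha := (alpha_map (pairing_Pr c) L).

(** This is T-linearity of alpha, where T acts on Hom(Q, L) by (t f)(q) = f(q t). *)
Lemma alpha_Pr_scale (t : T) x q : alpha (t *: x) q = alpha x (q :* t).
Proof.
elim/tensor_ind: x => [p l|x y hx hy]; last by rewrite scalerDr !raddfD /= hx hy.
by rewrite tensZ !alpha_PrE tensM.
Qed.

Fact ev_balanced : balanced (fun (q : Q) (p : P) => alpha (g p) q).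
Proof.
split=> *; first by rewrite raddfD.
- by rewrite !raddfD.
- by rewrite linearZ alpha_Pr_scale.
Qed.

(** The map h : J -> L before its descent along [toJ]. *)
Definition ev : {additive tensor Q P -> L} := tlift ev_balanced.

Lemma evZ (a : S) z : ev (a *: z) = a *: ev z.
Proof.
elim/tensor_ind: z => [q p|x y hx hy]; last first.
  by rewrite scalerDr !raddfD hx hy.
by rewrite tensZ !tliftE linearZ.
Qed.

(** For z = q' ⊗ p' both Morita identities enter: <q, p> q' = q <p, q'> moves the scalar into [g],
    then <p, q'> p' = p <q', p'>. The right side depends on [z] only through its image in J. *)
Lemma form_scale_ev q p z :
  (formS c (q ⊗ p) : S) *: ev z = alpha (g (p :* (formS c z : S))) q.
Proof.
elim/tensor_ind: z => [q' p'|x y hx hy].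
  by rewrite tliftE -linearZ formSQ -alpha_Pr_scale -linearZ formPS.
by rewrite (raddfD (formS c)) rscaleDr (raddfD ev) scalerDr hx hy !raddfD.
Qed.

Lemma ev_eq (Lf : classJF c L) z w : toJ z = toJ w -> ev z = ev w.
Proof.
move=> /(congr1 val) /= e; apply/eqP; rewrite -subr_eq0; apply/eqP.
move/classJFP: Lf; apply=> q p; rewrite scalerBr !form_scale_ev e.
exact: subrr.
Qed.

Lemma represented : right_alpha (pairing_Pr c) -> classJL c L ->
  exists l, adstat_map P L l = g.
Proof.
move=> al Lb; have Lf : classJF c L := bij_inj Lb.
(* Preimages under [toJ] are chosen arbitrarily; [hE] removes the choice, and linearity follows. *)
pose h (s : idealJ c) := ev (sval (cid (toJ_surj s))).
have hE z : h (toJ z) = ev z by rewrite /h; case: cid => w /=; exact: ev_eq.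
have h_lin : linear h.
  move=> a s s'; have [z <-] := toJ_surj s; have [w <-] := toJ_surj s'.
  by rewrite -linearP !hE raddfD evZ.
pose hL := GRing.isLinear.Build S (idealJ c) L *:%R h h_lin.
have [k _ kK] := Lb.
pose H : Hom (idealJ c) L := HB.pack h hL.
exists (k H); apply: HomP => p; apply: (al L); apply: HomP => q.
(* After alpha and evaluation at [q] the claim reads <q, p> k(H) = h(<q, p>). *)
rewrite [LHS]alpha_PrE -[RHS](tliftE ev_balanced) -[RHS]hE.
exact: (congr1 (fun f : Hom (idealJ c) L => f (toJ (q ⊗ p))) (kK H)).
Qed.

End Representing.

Lemma classJL_adstat :
  right_alpha (pairing_Pr c) -> classJL c L -> adstat P L.
Proof.
move=> al Lb; have Lf := classJF_tensor_faithful (bij_inj Lb).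
have rep g := cid (represented g al Lb).
exists (fun g => sval (rep g)) => [l|g]; last exact: svalP (rep g).
(* A right inverse of an injective map is also a left inverse. *)
have inj : injective (adstat_map P L).
  apply: raddf_inj => l' l0; apply: Lf => p.
  exact: (congr1 (fun f : Hom P (tensor P L) => f p) l0).
exact/inj/(svalP (rep _)).
Qed.

End Morita.

Theorem theorem6p4 (T S : pzRingType) (P : bimodType T S) (Q : bimodType S T)
    (c : moritaContext P Q) (E : lmodType T)
    (injE : injective_module E) (cogE : cogenerator E) :
  [/\ forall L : lmodType S, classJL c L -> classJF c L,
      forall L : lmodType S, classJF c L -> cogen (sharp P E) L,
      forall L : lmodType S, adstat P L -> cogen (sharp P E) L &
      right_alpha (pairing_Qr c) ->
      [/\ pure_right (inclJ c) /\
          (forall L : lmodType S, classJC c L -> cogen (sharp P E) L),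
          right_alpha (pairing_Pr c) ->
          [/\ forall L : lmodType S, classJL c L -> adstat P L,
              forall L : lmodType S, adstat P L -> cogen (sharp P E) L &
              forall L : lmodType S, cogen (sharp P E) L -> classJF c L] &
          right_alpha (pairing_Pr c) ->
          (forall L : lmodType S, cogen (sharp P E) L -> classJL c L) ->
          (forall L : lmodType S, classJL c L <-> cogen (sharp P E) L) /\
          (forall L : lmodType S, cogen (sharp P E) L <-> adstat P L)]].
Proof.
have JF_cogen L : classJF c L -> cogen (sharp P E) L.
  by move=> /classJF_tensor_faithful; exact: tensor_faithful_cogen.
have ad_cogen L : adstat P L -> cogen (sharp P E) L.
  by move=> /adstat_tensor_faithful; exact: tensor_faithful_cogen.
split=> // [L|alQ]; first exact: bij_inj.
split=> [|alP|alP cogen_JL].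
- split=> L; first exact: tensor_map_inclJ_inj.
  by move=> /(classJC_tensor_faithful alQ); exact: tensor_faithful_cogen.
- split=> // L; first exact: classJL_adstat.
  by move=> /cogen_tensor_faithful; exact: tensor_faithful_classJF.
(* The extra hypothesis closes the cycle JL ⊆ Adstat ⊆ Cogen ⊆ JL. *)
- split=> L; split=> [h|]; last 1 first.
  + exact: ad_cogen.
  + by apply: ad_cogen; exact: classJL_adstat h.
  + exact: cogen_JL.
  + exact/(classJL_adstat alP)/cogen_JL.
Qed.
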